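(* Let $\kappa>\aleph_0$ be an uncountable cardinal such that $\kappa^{<\kappa}=\kappa$. Then there exists an abelian group $\mathbb{G}_\kappa$ equipped with an invariant metric, of density $\kappa$, such that for every abelian group $H$ equipped with an invariant metric $d_H$ and of density at most $\kappa$ there exists an isometric group monomorphism $H\hookrightarrow\mathbb{G}_\kappa$.
   Context: The condition $\kappa^{<\kappa}=\kappa$ means $\sup_{\gamma<\kappa}\kappa^{\gamma}=\kappa$, where $\gamma$ ranges over cardinals below $\kappa$. A metric $d$ on an abelian group $G$ (written additively) is invariant if $d(x+z,y+z)=d(x,y)$ for all $x,y,z\in G$. The density of a metric space is the least cardinality of a dense subset. *)

(* Defs.v *)
From HB Require Import structures.
From mathcomp Require Import all_boot all_order all_algebra.
From mathcomp Require Import all_classical all_reals topology.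

Set Implicit Arguments.
Unset Strict Implicit.
Unset Printing Implicit Defensive.

Import Order.TTheory GRing.Theory Num.Theory.

Local Open Scope classical_set_scope.
Local Open Scope ring_scope.
Local Open Scope card_scope.

(* Cardinals are represented by types, up to equipotence. *)
Definition card_type_le (A B : Type) : Prop := [set: A] #<= [set: B].

Definition card_type_lt (A B : Type) : Prop :=
  card_type_le A B /\ ~ card_type_le B A.

Definition bounds_weak_power (K M : Type) : Prop :=
  forall L : Type, card_type_lt L K -> card_type_le (L -> K) M.

(* [K ^ <K = S], where [K ^ <K] is the supremum of the [K ^ L] for [L < K]. *)
Definition weak_power_eq (K S : Type) : Prop :=
  bounds_weak_power K S /\
  forall M : Type, bounds_weak_power K M -> card_type_le S M.

Definition has_density (T : topologicalType) (K : Type) : Prop :=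
  (exists D : set T, dense D /\ D #= [set: K]) /\
  forall D : set T, dense D -> [set: K] #<= D.

Definition has_density_le (T : topologicalType) (K : Type) : Prop :=
  exists L : Type, has_density T L /\ card_type_le L K.

HB.mixin Record Metric_isInvariant (R : numDomainType) (G : Type)
    & Metric R G & GRing.Zmodule G := {
  mdistDr : forall x y z : G, mdist (x + z) (y + z) = mdist x y
}.

#[short(type="invMetricZmodType")]
HB.structure Definition InvMetricZmodule (R : numDomainType) :=
  { G of Metric R G & GRing.Zmodule G & Metric_isInvariant R G }.

Definition isometric (R : numDomainType) (S T : metricType R) (f : S -> T) :=
  forall x y, mdist (f x) (f y) = mdist x y.

(* Main.v *)
Require Import Defs.
From HB Require Import structures.
From mathcomp Require Import all_boot all_order all_algebra.
From mathcomp Require Import all_classical all_reals topology.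
From mathcomp Require Import wochoice lra.

(** A group with invariant metric and at most [K] elements is the quotient of
the free abelian group [F] on [K] by a seminorm. Well-order [K] so that proper
initial segments are smaller than [K], and let [F_k] be the subgroup of [F]
generated by the elements up to [k]. A node is a pair [(k, p)] of a level [k]
and a seminorm [p] on [F_k]; since [K ^ <K = K], there are at most [K] nodes.
Each seminorm [p] on [F] embeds [F] into the free abelian group [A] on the nodes
by [e_k |-> e_(k, p|F_k)], so that the images for [p] and [q] share the part on
which [p] and [q] agree. The largest seminorm on [A] which is at most [p] on the
image for [p], for every [p], induces exactly [p] there (a tree-like
amalgamation), hence the quotient of [A] by this seminorm is universal. *)

Set Implicit Arguments.
Unset Strict Implicit.
Unset Printing Implicit Defensive.

Import Order.TTheory GRing.Theory Num.Theory.

Local Open Scope classical_set_scope.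
Local Open Scope card_scope.
Local Open Scope ring_scope.
Local Open Scope quotient_scope.

(** * Cardinal arithmetic below [K] *)

Lemma card_type_leP (A B : Type) :
  card_type_le A B <-> exists f : A -> B, injective f.
Proof.
split=> [/card_leP[g]|[f inj_f]].
  have sTP (T : Type) (x : T) : x \in [set: T] by rewrite in_setT.
  exists (fun a => \val (g (SigSub (sTP A a)))) => a b gab.
  have /(congr1 \val)//= : SigSub (sTP A a) = SigSub (sTP A b).
  by apply: (@inj _ _ _ g); rewrite ?in_setT//; apply: val_inj.
have /injfunPex[g] : exists2 g : A -> B, set_fun [set: A] [set: B] g &
    set_inj [set: A] g by exists f => // x y _ _; exact: inj_f.
exact: inj_card_le.
Qed.

Lemma card_type_le_trans (A B C : Type) :
  card_type_le A B -> card_type_le B C -> card_type_le A C.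
Proof. exact: card_le_trans. Qed.

Lemma inj_card_type_le (A B : Type) (f : A -> B) :
  injective f -> card_type_le A B.
Proof. by move=> fI; apply/card_type_leP; exists f. Qed.

Lemma surj_card_type_le (A B : Type) (f : A -> B) :
  (forall b, exists a, f a = b) -> card_type_le B A.
Proof.
by move=> /choice[g gK]; apply: (@inj_card_type_le _ _ g); exact: can_inj gK.
Qed.

Lemma card_type_le_fun (X A B : Type) :
  card_type_le A B -> card_type_le (X -> A) (X -> B).
Proof.
move=> /card_type_leP[f fI]; apply: (@inj_card_type_le _ _ (comp f)).
by move=> u v uv; apply/funext => x; apply: fI; have /funeqP := uv; exact.
Qed.

Lemma card_type_le_option_bool (X : Type) (x0 : X) :
  card_type_le (option X) (bool * X).
Proof.
apply: (@inj_card_type_le _ _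
  (fun o => if o is Some x then (true, x) else (false, x0))).
by move=> [x|] [y|]//= [->].
Qed.

(** A real is determined by its Dedekind cut, recorded as a set of codes of rationals. *)
Lemma card_type_le_real (R : realType) : card_type_le R (nat -> bool).
Proof.
apply: (@inj_card_type_le _ _
  (fun r n => if unpickle n is Some q then ratr q < r else false)%R) => r s rs.
have lt_irr (a b : R) : (a < b)%R -> (fun n : nat => if unpickle n is Some q
    then ratr q < a else false)%R <> (fun n : nat => if unpickle n is Some q
    then ratr q < b else false)%R.
  move=> ab /funeqP E; have [q] := rat_in_itvoo ab.
  rewrite in_itv/= => /andP[aq qb]; have := E (pickle q).
  by rewrite pickleK qb ltNge ltW.
have [rls|slr|//] := ltgtP r s; first by have := lt_irr _ _ rls.
by have := lt_irr _ _ slr; rewrite rs.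
Qed.

(* Cut an arbitrary well-order at the least point below which there are already
   [K] elements, if there is one. *)
Lemma exists_initial_well_order (K : eqType) : exists le : rel K,
  total_order le /\
  forall x, card_type_lt {y | le y x && (y != x)} K.
Proof.
have [r wo_r] := well_ordering_principle K.
have woc : wo_chain r predT by move=> A _; exact: wo_r.
have r_total x y : r x y || r y x :=
  wo_chainW woc (isT : x \in predT) (isT : y \in predT).
have r_refl x : r x x := wo_chain_reflexive woc (isT : x \in predT).
have r_anti x y : r x y && r y x -> x = y :=
  wo_chain_antisymmetric woc (isT : x \in predT) (isT : y \in predT).
have r_trans y x z : r x y -> r y z -> r x z.
  move=> xy yz; have [m [[]]] : exists! m, minimum_of r (mem [:: x; y; z]) m.
    by apply: wo_r; exists x; rewrite !inE eqxx.
  (* If the minimum of the triple is [y] or [z], antisymmetry makes two of the points equal. *)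
  rewrite !inE => /or3P[] /eqP-> m_min _.
  - by apply: m_min; rewrite !inE eqxx ?orbT.
  - have -> : x = y by apply: r_anti; rewrite xy m_min// !inE eqxx.
    by [].
  - have zy : y = z by apply: r_anti; rewrite yz m_min// !inE eqxx ?orbT.
    by rewrite -zy.
pose lt_seg x := {y | r y x && (y != x)}.
have lt_segK x : card_type_le (lt_seg x) K.
  by apply: (@inj_card_type_le _ _ sval); exact: val_inj.
have [[x0 Bx0]|noB] := pselect (exists x, card_type_le K (lt_seg x)); last first.
  exists r; split; first by split; [split; [split|]|].
  by move=> x; split; [exact: lt_segK|move=> Bx; apply: noB; exists x].
have [m [[]]] : exists! m,
    minimum_of r [pred x | `[< card_type_le K (lt_seg x) >]] m.
  by apply: wo_r; exists x0; exact/asboolP.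
move=> /asboolP /card_type_leP[f fI] m_min _.
(* The new order is [r] pulled back along [f], which injects [K] into the segment below [m]. *)
exists (fun a b => r (sval (f a)) (sval (f b))); split.
  split; last by move=> a b; exact: r_total.
  split; first by split=> [a|b a c]; [exact: r_refl|exact: r_trans].
  by move=> a b /r_anti /val_inj /fI.
move=> a; split.
  by apply: (@inj_card_type_le _ _ sval); exact: val_inj.
(* If the new segment below [a] had [K] elements, so would the [r]-segment below [f a], although
   [f a] lies strictly below the least such point [m]. *)
move=> Ka; have /andP[fam /eqP[]] := svalP (f a).
apply: r_anti; rewrite fam/=; apply: m_min; apply/asboolP.
apply: (card_type_le_trans Ka).
have h (y : {y | r (sval (f y)) (sval (f a)) && (y != a)}) :
    r (sval (f (sval y))) (sval (f a)) && (sval (f (sval y)) != sval (f a)).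
  have /andP[-> ya] := svalP y; apply: contra ya => /eqP/val_inj/fI ya.
  exact/eqP.
pose g y : lt_seg (sval (f a)) := 
  exist (fun z => r z _ && (z != _)) (sval (f (sval y))) (h y).
apply: (@inj_card_type_le _ _ g).
by move=> y z /(congr1 sval)/= /val_inj /fI /val_inj.
Qed.

Section SmallExponents.
Context (K : Type) (K_uncountable : ~ countable [set: K])
  (K_pow : bounds_weak_power K K).

(* [X] is an admissible exponent; this class is closed under products and finite
   sequences by currying alone, without any absorption law for cardinals. *)
Definition small (X : Type) : Prop := card_type_le (X -> K) K.

Lemma lt_small (X : Type) : card_type_lt X K -> small X.
Proof. exact: K_pow. Qed.

Lemma uncountable_inhabited : exists k : K, True.
Proof.
apply/not_existsP => noK; apply: K_uncountable.
by apply/card_type_leP; exists (fun=> 0%N) => k; have := noK k.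
Qed.

(** Functions on [Y] extend to [X] along the injection, with the default value [k0] off its
    range. *)
Lemma small_le (X Y : Type) : card_type_le Y X -> small X -> small Y.
Proof.
move=> /card_type_leP[f fI]; apply: card_type_le_trans.
have [k0 _] := uncountable_inhabited.
pose ext (u : Y -> K) x :=
  if pselect (exists y, f y = x) is left h then u (projT1 (cid h)) else k0.
apply: (@inj_card_type_le _ _ ext) => u v /funeqP uv; apply/funext => y.
have := uv (f y); rewrite /ext; case: pselect => [h|[]]; last by exists y.
by case: cid => /= z /fI ->.
Qed.

Lemma surj_small (X Y : Type) (f : X -> Y) :
  (forall y, exists x, f x = y) -> small X -> small Y.
Proof. by move=> /surj_card_type_le; exact: small_le. Qed.

Lemma small_prod (X Y : Type) : small X -> small Y -> small (X * Y).
Proof.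
move=> sX sY; apply: card_type_le_trans sX.
apply: card_type_le_trans (card_type_le_fun X sY).
apply: (@inj_card_type_le _ _ (fun u x y => u (x, y))) => u v uv.
by apply/funext => -[x y]; have /funeqP/(_ x)/funeqP := uv; exact.
Qed.

Lemma card_type_le_countType (X : countType) : card_type_le X K.
Proof.
apply: (@card_type_le_trans _ nat).
  exact: inj_card_type_le (pcan_inj pickleK).
by apply/infiniteP => /finite_set_countable.
Qed.

Lemma small_nat : small nat.
Proof.
by apply: lt_small; split; [exact: card_type_le_countType|exact: K_uncountable].
Qed.

Lemma small_countType (X : countType) : small X.
Proof.
by apply: small_le small_nat; exact: inj_card_type_le (pcan_inj pickleK).
Qed.

(** A pair is a function on [bool], and [bool] is an admissible exponent. *)
Lemma card_type_le_prod (X Y : Type) :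
  card_type_le X K -> card_type_le Y K -> card_type_le (X * Y) K.
Proof.
move=> /card_type_leP[f fI] /card_type_leP[g gI].
apply: card_type_le_trans (small_countType bool).
apply: (@inj_card_type_le _ _ (fun u (b : bool) => if b then f u.1 else g u.2)).
move=> [x y] [x' y'] /funeqP E.
by congr pair; [exact: fI (E true)|exact: gI (E false)].
Qed.

Lemma card_type_le_option (X : Type) :
  card_type_le X K -> card_type_le (option X) K.
Proof.
have [k0 _] := uncountable_inhabited.
move=> /card_type_leP[f fI].
apply: (@card_type_le_trans _ (option K)).
  by apply: (@inj_card_type_le _ _ (omap f)) => -[x|] [y|]//= [/fI ->].
apply: card_type_le_trans (card_type_le_option_bool k0) _.
by apply: card_type_le_prod (card_lexx _); exact: card_type_le_countType.
Qed.

Lemma card_type_le_small_fun (X Y : Type) :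
  small X -> card_type_le Y K -> card_type_le (X -> Y) K.
Proof. by move=> sX /(card_type_le_fun X) YK; exact: card_type_le_trans sX. Qed.

(** A finite sequence is a function from [nat] to [option X], and [nat] is an admissible exponent
    because [K] is uncountable. *)
Lemma card_type_le_seq (X : Type) : card_type_le X K -> card_type_le (seq X) K.
Proof.
move=> /card_type_le_option /(card_type_le_small_fun small_nat).
apply: card_type_le_trans; apply: (@inj_card_type_le _ _ (@onth X)).
elim=> [|x s IHs] [|y t] /funeqP E //=; have := E 0%N; rewrite //=.
by move=> [->]; congr cons; apply: IHs; apply/funext => n; have := E n.+1.
Qed.

Lemma small_option (X : Type) : small X -> small (option X).
Proof.
move=> sX; apply: card_type_le_trans (card_type_le_prod sX (card_lexx _)).
apply: (@inj_card_type_le _ _ 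
  (fun u : option X -> K => (u \o some, u None))) => u v [/funeqP uv uvN].
by apply/funext => -[x|//]; exact: uv.
Qed.

Lemma small_tuple (X : Type) n : small X -> small (n.-tuple X).
Proof.
move=> sX; elim: n => [|n IHn].
  apply: (@inj_card_type_le _ _ (fun u : 0.-tuple X -> K => u [tuple])) => u v uv.
  by apply/funext => t; rewrite (tuple0 t).
apply: (@surj_small (X * n.-tuple X) _ (fun u => [tuple of u.1 :: u.2])).
  by move=> t; exists (thead t, [tuple of behead t]); rewrite [RHS]tuple_eta.
exact: small_prod.
Qed.

(** A function on [seq X] is a family, indexed by the length [n], of functions on [n]-tuples. Each
    member is coded by one element of [K], which leaves a function from [nat] to [K]. *)
Lemma small_seq (X : Type) : small X -> small (seq X).
Proof.
move=> sX; have ex_c n : exists c : (n.-tuple X -> K) -> K, injective c.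
  exact/card_type_leP/small_tuple.
pose c n := projT1 (cid (ex_c n)).
have cI n : injective (c n) by exact: projT2 (cid (ex_c n)).
apply: card_type_le_trans small_nat.
apply: (@inj_card_type_le _ _ 
  (fun (u : seq X -> K) n => c n (u \o val))) => u v /funeqP uv.
by apply/funext => s; have /cI/funeqP/(_ (in_tuple s)) := uv (size s).
Qed.

Lemma card_type_le_realType (R : realType) : card_type_le R K.
Proof.
apply: card_type_le_trans (card_type_le_real R) _.
exact: card_type_le_small_fun small_nat (card_type_le_countType bool).
Qed.

End SmallExponents.

(** * Finitely supported integer functions *)

Section FreeAbelianGroup.
Context (X : choiceType).

Definition finsupp : {pred X -> int} :=
  [pred a | `[< finite_set [set x | a x != 0] >]].

Lemma finsuppP (a : X -> int) :
  reflect (exists s : seq X, forall x, a x != 0 -> x \in s) (a \in finsupp).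
Proof.
apply: (iffP (asboolP _)) => [/finite_seqP[s sE]|[s sP]].
  by exists s => x ax; have : [set y | a y != 0] x by []; rewrite sE.
by apply: sub_finite_set (finite_seq s) => x; exact: sP.
Qed.

Lemma finsupp_zmod_closed : zmod_closed finsupp.
Proof.
split; first by apply/finsuppP; exists [::] => x; rewrite eqxx.
move=> a b /finsuppP[s sP] /finsuppP[t tP].
apply/finsuppP; exists (s ++ t) => x; rewrite mem_cat.
apply: contraNT => /norP[/(contraNN (@sP _)) /negPn/eqP ax].
move=> /(contraNN (@tP _)) /negPn/eqP bx.
by rewrite -[(a - b) x]/(a x - b x) ax bx subrr.
Qed.

HB.instance Definition _ := GRing.isZmodClosed.Build (X -> int) finsupp
  finsupp_zmod_closed.

Record freeab := Freeab { freeab_fun :> X -> int; _ : freeab_fun \in finsupp }.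

HB.instance Definition _ := [isSub for freeab_fun].
HB.instance Definition _ := [Choice of freeab by <:].
HB.instance Definition _ := [SubChoice_isSubZmodule of freeab by <:].

Implicit Types a b : freeab.

Lemma freeabP a b : (forall x, a x = b x) <-> a = b.
Proof. by split=> [ab|->//]; apply/val_inj/funext. Qed.

Lemma freeabE :
  ((forall x, (0 : freeab) x = 0%R) *
   (forall a x, (- a)%R x = (- a x)%R) *
   (forall a b x, (a + b)%R x = (a x + b x)%R))%type.
Proof. by []. Qed.

Lemma freeab_suppP a : exists s : seq X, forall x, a x != 0 -> x \in s.
Proof. exact/finsuppP/(valP a). Qed.

Lemma freeab_sumE (I : Type) (s : seq I) (F : I -> freeab) x :
  (\sum_(i <- s) F i) x = \sum_(i <- s) F i x.
Proof. exact: (big_morph (fun a : freeab => a x)). Qed.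

Lemma card_type_le_freeab : card_type_le freeab (seq (X * int)).
Proof.
have /choice[s sP] := freeab_suppP.
pose code a := [seq (x, a x) | x <- s a].
apply: (@inj_card_type_le _ _ code) => a b ab.
have supp c d x : code c = code d -> c x != 0 -> c x = d x.
  move=> cd cx; have : (x, c x) \in code c by apply/map_f/sP.
  by rewrite cd => /mapP[y _ [<- ->]].
apply/freeabP => x; have [ax0|/(supp _ _ _ ab)//] := eqVneq (a x) 0.
by have [->|/(supp _ _ _ (esym ab))] := eqVneq (b x) 0.
Qed.

Lemma gen_subproof x (n : int) : (fun y => if y == x then n else 0) \in finsupp.
Proof.
by apply/finsuppP; exists [:: x] => y; rewrite inE; case: (y == x).
Qed.

Definition gen x n := Freeab (gen_subproof x n).

Lemma freeab_sum_gen a : exists s, a = \sum_(x <- s) gen x (a x).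
Proof.
have [s0 sP0] := freeab_suppP a; exists (undup s0).
have sP x : a x != 0 -> x \in undup s0 by rewrite mem_undup; exact: sP0.
apply/freeabP => x; rewrite freeab_sumE/= -big_mkcond/=.
have [xs|/(contraNN (@sP _))/negPn/eqP ax] := boolP (x \in undup s0).
  rewrite -big_filter (eq_filter (a2 := pred1 x)); last exact: eq_sym.
  by rewrite filter_pred1_uniq ?undup_uniq// big_seq1.
by rewrite big1// => y /eqP <-.
Qed.

(** Sorting the support in decreasing order puts its maximum first. The maximum selects the top node
    of a term in the amalgamation. *)
Lemma freeab_max (le : rel X) a : total_order le -> a != 0 ->
  exists2 m, a m != 0 & forall x, a x != 0 -> le x m.
Proof.
move=> [[[le_refl le_trans] _] le_total] a0.
have [s sP] := freeab_suppP a.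
have [x0 ax0] : exists x0, a x0 != 0.
  apply/not_existsP => aE; move/eqP: a0; apply; apply/freeabP => x.
  by rewrite freeabE; apply/eqP/negPn/negP/aE.
pose t := sort (fun x y => le y x) [seq x <- s | a x != 0].
have tP x : (x \in t) = (a x != 0).
  rewrite mem_sort mem_filter; have [//|/sP ->] := eqVneq (a x) 0.
  by rewrite andbT.
have : sorted (fun x y => le y x) t by apply: sort_sorted => x y; exact: le_total.
clearbody t; move: {+}(tP x0); rewrite ax0.
case: t tP => // m t tP _ /= pt; exists m.
  by rewrite -tP mem_head.
move=> x; rewrite -tP inE => /predU1P[->|//]; first exact: le_refl.
apply/allP: x; apply: order_path_min pt => y x z xy yz.
exact: le_trans yz xy.
Qed.

Context (V : zmodType) (h : X -> V).

Definition lin_ext a : V := \sum_(x \in [set: X]) h x *~ a x.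

Lemma lin_extE (s : seq X) a : uniq s -> (forall x, a x != 0 -> x \in s) ->
  lin_ext a = \sum_(x <- s) h x *~ a x.
Proof.
move=> s_uniq sP; rewrite /lin_ext (fsbigE s)//.
  by apply: eq_bigl => x; rewrite in_setT.
by move=> x _ /(contraNN (@sP _))/negPn/eqP ->; rewrite mulr0z.
Qed.

Lemma lin_extB a b : lin_ext (a - b) = lin_ext a - lin_ext b.
Proof.
have [s sP] := freeab_suppP a; have [t tP] := freeab_suppP b.
rewrite !(@lin_extE (undup (s ++ t))) ?undup_uniq//.
- rewrite -sumrB; apply: eq_bigr => x _.
  by rewrite !freeabE mulrzDr mulrNz.
- by move=> x /tP xt; rewrite mem_undup mem_cat xt orbT.
- by move=> x /sP xs; rewrite mem_undup mem_cat xs.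
- move=> x; rewrite mem_undup mem_cat; apply: contraNT => /norP[].
  move=> /(contraNN (@sP _))/negPn/eqP ax /(contraNN (@tP _))/negPn/eqP bx.
  by rewrite !freeabE ax bx subrr.
Qed.

Lemma lin_ext_gen x n : lin_ext (gen x n) = h x *~ n.
Proof.
rewrite (@lin_extE [:: x])//; first by rewrite big_seq1 /= eqxx.
by move=> y; rewrite /= inE; case: (y == x).
Qed.

End FreeAbelianGroup.

Section Pushforward.
Context (X Y : choiceType) (i : X -> Y) (r : Y -> X).
Context (iK : cancel i r).

Lemma push_subproof (a : freeab X) :
  (fun y => if i (r y) == y then a (r y) else 0) \in @finsupp Y.
Proof.
have [s sP] := freeab_suppP a; apply/finsuppP; exists (map i s) => y.
by have [<-|] := eqVneq (i (r y)) y; rewrite ?eqxx// iK => /sP; exact: map_f.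
Qed.

(** The homomorphism induced by [i] on generators. The retraction [r] gives a pointwise formula
    without sums over fibres. *)
Definition push a := Freeab (push_subproof a).

Lemma pushB : {morph push : a b / a - b}.
Proof.
move=> a b; apply/freeabP => y; rewrite !freeabE/=.
by case: ifP => // _; rewrite subrr.
Qed.

Lemma push_gen x n : push (gen x n) = gen (i x) n.
Proof.
apply/freeabP => y /=; have [<-|yx] := eqVneq (i (r y)) y.
  by rewrite iK (can_eq iK).
by have [yE|//] := eqVneq y (i x); move: yx; rewrite yE iK eqxx.
Qed.

End Pushforward.

(** * Seminorms and their quotients *)

(** These are the distances to zero of invariant pseudometrics: the inequality for differences
    contains symmetry and nonnegativity as well, see [snormN] and [snorm_ge0]. *)
Definition seminorm (R : realType) (V : zmodType) (N : V -> R) : Prop :=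
  N 0 = 0 /\ forall x y, N (x - y) <= N x + N y.

Section Seminorm.
Context (R : realType) (V : zmodType) (N : V -> R) (N_snorm : seminorm N).

Lemma snorm0 : N 0 = 0. Proof. by case: N_snorm. Qed.

Lemma snormB x y : N (x - y) <= N x + N y. Proof. by case: N_snorm. Qed.

Lemma snormN x : N (- x) = N x.
Proof.
apply/eqP; rewrite eq_le; have := snormB 0 x; have := snormB 0 (- x).
by rewrite !sub0r opprK snorm0 !add0r => -> ->.
Qed.

Lemma snormD x y : N (x + y) <= N x + N y.
Proof. by rewrite -(snormN y) -{1}(opprK y) snormB. Qed.

Lemma snorm_ge0 x : 0 <= N x.
Proof. by have := snormB x x; rewrite subrr snorm0; lra. Qed.

Lemma snorm_eq x y : N (x - y) = 0 -> N x = N y.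
Proof.
move=> xy; have := snormD (x - y) y; have := snormB x (x - y).
by rewrite opprB addrC !subrK xy; lra.
Qed.

End Seminorm.

Section SeminormQuotient.
Context (R : realType) (V : zmodType) (N : V -> R) (N_snorm : seminorm N).

(** The proof is an argument of the predicate so that the subgroup instance can be attached to
    it. *)
Definition snorm_ker of seminorm N : {pred V} := [pred x | N x == 0].

Lemma snorm_ker_zmod_closed : zmod_closed (snorm_ker N_snorm).
Proof.
split=> [|x y /eqP Nx /eqP Ny]; first by rewrite inE (snorm0 N_snorm).
rewrite inE eq_le (snorm_ge0 N_snorm) andbT.
by rewrite (le_trans (snormB N_snorm _ _))// Nx Ny addr0.
Qed.

HB.instance Definition _ := GRing.isZmodClosed.Build V (snorm_ker N_snorm)
  snorm_ker_zmod_closed.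

Definition snorm_quot := Quotient.quot (snorm_ker N_snorm).

HB.instance Definition _ := GRing.Zmodule.on snorm_quot.

Definition snorm_pi (x : V) : snorm_quot := \pi_(snorm_quot) x.

Lemma snorm_pi_surj (a : snorm_quot) : exists x, snorm_pi x = a.
Proof. by exists (repr a); rewrite /snorm_pi reprK. Qed.

Lemma snorm_pi_eq x y : (snorm_pi x = snorm_pi y) <-> N (x - y) = 0.
Proof.
split.
  by move/eqP; rewrite /snorm_pi -Quotient.idealrBE inE => /eqP.
by move=> xy; apply/eqP; rewrite /snorm_pi -Quotient.idealrBE inE xy.
Qed.

Lemma snorm_piB : {morph snorm_pi : x y / x - y}.
Proof. by move=> x y; rewrite /snorm_pi !raddfB. Qed.

Definition snorm_dist (a b : snorm_quot) : R := N (repr a - repr b).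

Lemma snorm_dist_pi x y : snorm_dist (snorm_pi x) (snorm_pi y) = N (x - y).
Proof.
apply: (snorm_eq N_snorm); apply/snorm_pi_eq.
by rewrite !snorm_piB /snorm_pi !reprK.
Qed.

Lemma snorm_distxx a : snorm_dist a a = 0.
Proof. by rewrite /snorm_dist subrr (snorm0 N_snorm). Qed.

Lemma snorm_dist_eq0 a b : snorm_dist a b = 0 -> a = b.
Proof. by move/snorm_pi_eq; rewrite /snorm_pi !reprK. Qed.

Lemma snorm_distC a b : snorm_dist a b = snorm_dist b a.
Proof. by rewrite /snorm_dist -(snormN N_snorm) opprB. Qed.

Lemma snorm_dist_triangle b a c :
  snorm_dist a c <= snorm_dist a b + snorm_dist b c.
Proof.
rewrite /snorm_dist (le_trans _ (snormD N_snorm _ _))//.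
by rewrite addrA subrK.
Qed.

HB.instance Definition _ := @isMetric.Build R snorm_quot snorm_dist snorm_distxx
  snorm_dist_eq0 snorm_distC snorm_dist_triangle.

Lemma snorm_distDr (a b c : snorm_quot) : mdist (a + c) (b + c) = mdist a b.
Proof.
have [x <-] := snorm_pi_surj a; have [y <-] := snorm_pi_surj b.
have [z <-] := snorm_pi_surj c.
have piD u v : snorm_pi u + snorm_pi v = snorm_pi (u + v).
  by rewrite /snorm_pi raddfD.
rewrite !piD -[mdist _ _]/(snorm_dist _ _) -[RHS]/(snorm_dist _ _).
by rewrite !snorm_dist_pi opprD addrACA subrr addr0.
Qed.

HB.instance Definition _ :=
  Metric_isInvariant.Build R snorm_quot snorm_distDr.

End SeminormQuotient.

Lemma seminorm_quotient (R : realType) (V : zmodType) (N : V -> R) :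
  seminorm N -> exists (G : invMetricZmodType R) (pi : V -> G),
  [/\ forall a, exists x, pi x = a, {morph pi : x y / x - y} &
      forall x y, mdist (pi x) (pi y) = N (x - y)].
Proof.
move=> N_snorm; exists (snorm_quot N_snorm), (@snorm_pi R V N N_snorm); split.
- exact: snorm_pi_surj.
- exact: snorm_piB.
- exact: snorm_dist_pi.
Qed.

(** * Amalgamation along the tree of nodes *)

Section AmalgamatedSum.
Context (R : realType) (K : choiceType) (le : rel K).
Context (le_total : total_order le).

Lemma restrict_subproof k (a : freeab K) :
  (fun x => if le x k then a x else 0) \in @finsupp K.
Proof.
have [s sP] := freeab_suppP a; apply/finsuppP; exists s => x.
by case: ifP => // _; exact: sP.
Qed.

Definition restrict k a := Freeab (restrict_subproof k a).

Lemma restrictB k : zmod_morphism (restrict k).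
Proof.
move=> a b; apply/freeabP => x; rewrite !freeabE/=.
by case: ifP => // _; rewrite subrr.
Qed.

HB.instance Definition _ k :=
  GRing.isZmodMorphism.Build (freeab K) (freeab K) (restrict k) (restrictB k).

Lemma restrict_id k (a : freeab K) :
  (forall x, a x != 0 -> le x k) -> restrict k a = a.
Proof.
move=> ak; apply/freeabP => x /=; case: ifPn => // /(contraNN (@ak _)).
by move=> /negPn/eqP.
Qed.

Lemma restrict_restrict k l a : le l k ->
  restrict k (restrict l a) = restrict l a.
Proof.
case: le_total => -[[_ le_trans] _] _ lk; apply: restrict_id => x /=.
by case: ifP => // xl _; exact: le_trans lk.
Qed.

Let le_refl : reflexive le. Proof. by case: le_total => -[[]]. Qed.

(* Seminorms on the subgroup [F_k] generated by the elements up to [k] are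
   represented by the seminorms [p] on the whole group with
   [p = p \o restrict k]. *)
Definition snorms := {p : freeab K -> R | `[< seminorm p >]}.

Lemma snormsP (p : snorms) : seminorm (sval p).
Proof. exact/asboolP/(svalP p). Qed.

Definition Snorm (p : freeab K -> R) (p_snorm : seminorm p) : snorms :=
  exist (fun p => `[< seminorm p >]) p (asboolT p_snorm).

Lemma restrict_snorm_subproof k (p : snorms) : seminorm (sval p \o restrict k).
Proof.
split=> [|a b] /=; first by rewrite raddf0 (snorm0 (snormsP p)).
by rewrite raddfB (snormB (snormsP p)).
Qed.

Definition restrict_snorm k (p : snorms) : snorms :=
  Snorm (restrict_snorm_subproof k p).

Definition node := {t : K * snorms | restrict_snorm t.1 t.2 == t.2}.

Lemma node_of_subproof (p : snorms) k :
  restrict_snorm k (restrict_snorm k p) == restrict_snorm k p.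
Proof.
by apply/eqP/val_inj/funext => a /=; rewrite restrict_restrict.
Qed.

Definition node_of (p : snorms) k : node :=
  exist (fun t => restrict_snorm t.1 t.2 == t.2) (k, restrict_snorm k p)
    (node_of_subproof p k).

Definition node_level (t : node) : K := (sval t).1.

Definition node_snorm (t : node) : snorms := (sval t).2.

Lemma node_ofK p : cancel (node_of p) node_level.
Proof. by []. Qed.

Lemma node_snormK t : node_of (node_snorm t) (node_level t) = t.
Proof.
have /eqP pE := svalP t; apply/val_inj => /=.
by rewrite /node_level /node_snorm pE -surjective_pairing.
Qed.

Definition emb p : freeab K -> freeab node := push (@node_ofK p).

Lemma emb_node p (x : freeab K) k : emb p x (node_of p k) = x k.
Proof. by rewrite /= eqxx. Qed.

Lemma embB p : zmod_morphism (emb p).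
Proof. exact: pushB. Qed.

HB.instance Definition _ p :=
  GRing.isZmodMorphism.Build (freeab K) (freeab node) (emb p) (embB p).

(** The tree property: a node determines its predecessors, since the projection to [F_l] factors
    through [F_k]. *)
Lemma node_of_le p q k l :
  node_of p k = node_of q k -> le l k -> node_of p l = node_of q l.
Proof.
move=> /(congr1 node_snorm) /(congr1 sval)/= pq lk.
apply/val_inj; congr pair; apply/val_inj/funext => a /=.
by have /funeqP/(_ (restrict l a)) := pq; rewrite /= restrict_restrict.
Qed.

Lemma emb_eq p q k (x : freeab K) : node_of p k = node_of q k ->
  (forall l, x l != 0 -> le l k) -> emb p x = emb q x.
Proof.
move=> pq xk; apply/freeabP => t /=.
have [->|/xk lk] := eqVneq (x (node_level t)) 0.
  by case: (node_of p _ == t); case: (node_of q _ == t).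
by rewrite (node_of_le pq lk).
Qed.

Lemma snorm_node_eq (p q : snorms) k (x : freeab K) : node_of p k = node_of q k ->
  (forall l, x l != 0 -> le l k) -> sval p x = sval q x.
Proof.
move=> /(congr1 node_snorm) /(congr1 sval)/funeqP/(_ x)/= pq xk.
by rewrite -(restrict_id xk).
Qed.

(* Let [m] be the maximum of the support of the first term [(p, x)]. The
   coordinate at the node [(m, p|F_m)] must be met by another term (or by [q]),
   whose seminorm then agrees with [p] on [F_m]; merge [x] into that term. *)
Lemma emb_sum_snorm_le (s : seq (snorms * freeab K)) q y :
  \sum_(u <- s) emb u.1 u.2 = emb q y ->
  sval q y <= \sum_(u <- s) sval u.1 u.2.
Proof.
have [n] := ubnP (size s); elim: n => // n IHn in s y *.
case: s => [_|[p x] s /= sn].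
  rewrite !big_nil => emby; suff -> : y = 0 by rewrite (snorm0 (snormsP q)).
  by apply/freeabP => k; rewrite -(emb_node q) -emby.
rewrite !big_cons /=; have [->|x0] := eqVneq x 0.
  by rewrite raddf0 (snorm0 (snormsP p)) !add0r; exact: IHn.
have [m xm xle] := freeab_max le_total x0.
have [qp|qp] := eqVneq (node_of q m) (node_of p m).
  (* Here [q] itself passes through the node: [x] moves to the right-hand side, and the shorter sum
     has target [y - x]. *)
  rewrite -(emb_eq qp xle) -(snorm_node_eq qp xle) => sE.
  have {}sE : \sum_(u <- s) emb u.1 u.2 = emb q (y - x).
    by rewrite (embB q) -sE addrC addKr.
  have := IHn _ _ sn sE; have := snormD (snormsP q) (y - x) x.
  by rewrite subrK; lra.
have [/hasP[u us /eqP up]|/hasPn no] :=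
  boolP (has (fun u => node_of u.1 m == node_of p m) s).
  rewrite -(emb_eq up xle) -(snorm_node_eq up xle) !(perm_big _ (perm_to_rem us)).
  rewrite !big_cons addrA => sE.
  have := IHn ((u.1, u.2 + x) :: rem u s) y.
  rewrite !big_cons /= size_rem// prednK; last by case: (s) us.
  rewrite -sE => /(_ sn) H.
  apply: (le_trans (H _)); last first.
    by rewrite addrA lerD2r addrC snormD//; exact: snormsP.
  by rewrite raddfD [_ + emb _ x]addrC.
move=> /(congr1 (fun a : freeab node => a (node_of p m))).
rewrite freeabE freeab_sumE emb_node big_seq big1 ?addr0 /=; last first.
  by move=> u /no /negPf; rewrite /node_level/= => ->.
by rewrite /node_level/= (negPf qp) => xm0; rewrite xm0 eqxx in xm.
Qed.

(** The largest seminorm below all the given ones, as the infimum of the costs of finite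
    decompositions into elements of the images. *)
Definition amalg_norm (a : freeab node) : R :=
  inf [set c | exists2 s : seq (snorms * freeab K),
    a = \sum_(u <- s) emb u.1 u.2 & c = \sum_(u <- s) sval u.1 u.2].

Lemma amalg_norm_le (s : seq (snorms * freeab K)) :
  amalg_norm (\sum_(u <- s) emb u.1 u.2) <= \sum_(u <- s) sval u.1 u.2.
Proof.
apply: ge_inf; last by exists s.
exists 0 => _ [t _ ->]; apply: sumr_ge0 => u _.
exact/snorm_ge0/snormsP.
Qed.

(** Every node lies on the branch of its own seminorm. Hence the infimum in [amalg_norm] is over a
    nonempty set. *)
Lemma emb_generate (a : freeab node) :
  exists s : seq (snorms * freeab K), a = \sum_(u <- s) emb u.1 u.2.
Proof.
have [s sE] := freeab_sum_gen a.
exists [seq (node_snorm t, gen (node_level t) (a t)) | t <- s].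
rewrite big_map {1}sE; apply: eq_bigr => t _ /=.
by rewrite /emb push_gen node_snormK.
Qed.

Lemma le_amalg_norm (a : freeab node) c :
  (forall s : seq (snorms * freeab K), a = \sum_(u <- s) emb u.1 u.2 ->
    c <= \sum_(u <- s) sval u.1 u.2) ->
  c <= amalg_norm a.
Proof.
move=> ac; apply: lb_le_inf; last by move=> _ [s /ac + ->].
by have [s sE] := emb_generate a; exists (\sum_(u <- s) sval u.1 u.2), s.
Qed.

(** The one-term decomposition gives the upper bound; by the tree argument no decomposition is
    cheaper. *)
Lemma amalg_norm_emb p x : amalg_norm (emb p x) = sval p x.
Proof.
apply/eqP; rewrite eq_le; apply/andP; split.
  by have := amalg_norm_le [:: (p, x)]; rewrite !big_seq1.
by apply: le_amalg_norm => s /esym; exact: emb_sum_snorm_le.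
Qed.

Lemma amalg_norm_seminorm : seminorm amalg_norm.
Proof.
split=> [|a b].
  apply/eqP; rewrite eq_le; apply/andP; split.
    by have := amalg_norm_le [::]; rewrite !big_nil.
  by apply: le_amalg_norm => s _; apply: sumr_ge0 => u _; exact/snorm_ge0/snormsP.
rewrite -lerBlDr; apply: le_amalg_norm => s sE.
rewrite lerBlDl -lerBlDr; apply: le_amalg_norm => t tE.
rewrite lerBlDl.
(* A decomposition of [a] followed by the negated one of [b] decomposes [a - b], at the sum of the
   two costs. *)
have := amalg_norm_le (s ++ [seq (u.1, - u.2) | u <- t]).
rewrite !big_cat !big_map /= -sE.
under eq_bigr do rewrite raddfN.
rewrite sumrN -tE => /le_trans; apply; rewrite lerD2l.
by apply: ler_sum => u _; rewrite (snormN (snormsP u.1)).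
Qed.

(** * Counting the nodes *)

Section Cardinality.
Context (K_uncountable : ~ countable [set: K])
  (K_pow : bounds_weak_power K K)
  (le_small : forall k, small K {l | le l k}).

(** An element of [F_k] is coded by a finite sequence of pairs of an index up to [k] and an integer,
    and admissible exponents are closed under these constructions. *)
Lemma small_restrict k : small K {a | restrict k a == a}.
Proof.
have small_code : small K (seq ({l | le l k} * int)).
  apply: small_seq => //; apply: small_prod => //.
  exact: small_countType.
apply: small_le small_code => //.
apply: card_type_le_trans (card_type_le_freeab _).
have supp (a : freeab K) : (fun l : {l | le l k} => a (sval l)) \in @finsupp _.
  have [s sP] := freeab_suppP a; apply/finsuppP; exists (pmap insub s) => l.
  by move=> /sP; rewrite mem_pmap_sub.
apply: (@inj_card_type_le _ _ (fun a => Freeab (supp (sval a)))).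
move=> a b /freeabP /= ab; apply/val_inj => /=.
have /eqP <- := svalP a; have /eqP <- := svalP b.
apply/freeabP => l /=; case: ifP => // lk.
exact: ab (exist _ l lk).
Qed.

(** There are [K] levels, and a seminorm at level [k] is a real function on [F_k], which is an
    admissible exponent. *)
Lemma card_type_le_node : card_type_le node K.
Proof.
have ex_c k : exists c : ({a | restrict k a == a} -> R) -> K, injective c.
  apply/card_type_leP; apply: card_type_le_small_fun (small_restrict k) _ => //.
  exact: card_type_le_realType.
pose c k := projT1 (cid (ex_c k)).
have cI k : injective (c k) by exact: projT2 (cid (ex_c k)).
apply: card_type_le_trans (card_type_le_prod K_uncountable K_pow
  (card_lexx [set: K]) (card_lexx [set: K])).
apply: (@inj_card_type_le _ _ (fun t : node =>
  (node_level t, c (node_level t) (fun a => sval (node_snorm t) (sval a))))).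
move=> [[k p] /= pk] [[l q] /= ql]; rewrite /node_level/node_snorm/=.
move=> [kl]; rewrite {}kl in pk *; move=> /cI/funeqP pq.
apply/val_inj => /=; congr pair; move/eqP: pk => <-; move/eqP: ql => <-.
apply/val_inj/funext => a /=.
have ra : restrict l (restrict l a) == restrict l a by rewrite restrict_restrict.
exact: pq (exist (fun a => restrict l a == a) _ ra).
Qed.

Lemma card_type_le_freeab_node : card_type_le (freeab node) K.
Proof.
apply: card_type_le_trans (card_type_le_freeab _) _.
apply: card_type_le_seq => //; apply: card_type_le_prod => //.
  exact: card_type_le_node.
exact: card_type_le_countType.
Qed.

End Cardinality.

End AmalgamatedSum.

(** * Density and universality *)

Lemma dense_mdist (R : realType) (T : metricType R) (D : set T) (x : T) (e : R) :
  dense D -> 0 < e -> exists d : set_type D, mdist x (sval d) < e.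
Proof.
move=> D_dense e0.
have [|d [/interior_subset xd Dd]] := D_dense _ _ (open_interior (ball x e)).
  by exists x; apply: nbhs_singleton; apply: nbhs_interior; exact: nbhsx_ballx.
by exists (SigSub (mem_set Dd)); move: xd; rewrite ballEmdist.
Qed.

Section Density.
Context (R : realType) (T : metricType R) (K : Type).

(** Points of [D] chosen within [e / 2] of the separated points are distinct. *)
Lemma card_type_le_separated (D : set T) (f : K -> T) (e : R) : 0 < e ->
  (forall k l, mdist (f k) (f l) < e -> k = l) ->
  dense D -> [set: K] #<= D.
Proof.
move=> e0 f_sep D_dense.
have e20 : 0 < e / 2 by rewrite divr_gt0.
have /choice[d dP] k := dense_mdist (f k) D_dense e20.
rewrite -(card_le_eqr (card_setT D)); apply/card_type_leP; exists d => k l kl.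
apply: f_sep; rewrite (le_lt_trans (metric_triangle _ (sval (d k)) _))//.
by rewrite [e]splitr ltrD// kl metric_sym.
Qed.

Context (K_uncountable : ~ countable [set: K]) (K_pow : bounds_weak_power K K).

(** A point is determined by a sequence of the dense set converging to it, and there are at most [K]
    such sequences. *)
Lemma has_density_le_card : has_density_le T K -> card_type_le T K.
Proof.
move=> [L [[[D [D_dense DL]] _] LK]].
have {DL LK}DK : card_type_le (set_type D) K.
  by rewrite /card_type_le (card_le_eql (card_setT D)) (card_le_eql DL).
have inv_gt0 n : 0 < n.+1%:R^-1 :> R by rewrite invr_gt0.
have /choice[d dP] x :
    exists d : nat -> set_type D, forall n, mdist x (sval (d n)) < n.+1%:R^-1.
  have [d dP] := choice (fun n => dense_mdist x D_dense (inv_gt0 n)).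
  by exists d.
apply: card_type_le_trans (card_type_le_small_fun (small_nat _ _) DK) => //.
apply: (@inj_card_type_le _ _ d) => x y xy; apply/mdist_positivity/eqP.
rewrite eq_le mdist_ge0 andbT leNgt; apply/negP => xy0.
have [n] := ltr_add_invr (divr_gt0 xy0 (ltr0Sn R 1)).
rewrite add0r => nxy; have := metric_triangle x (sval (d x n)) y.
rewrite leNgt => /negP; apply; rewrite [ltRHS]splitr.
by rewrite ltrD ?(lt_trans _ nxy)// xy metric_sym.
Qed.

End Density.

Lemma mdistB (R : realType) (H : invMetricZmodType R) (x y : H) :
  mdist (x - y) 0 = mdist x y :> R.
Proof. by rewrite -(mdistDr _ _ y) subrK add0r. Qed.

Lemma mdist_seminorm (R : realType) (H : invMetricZmodType R) :
  seminorm (fun x : H => mdist x 0 : R).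
Proof.
split=> [|x y]; first exact: mdistxx.
rewrite mdistB [mdist y 0]metric_sym.
exact: metric_triangle.
Qed.

(** Its branch puts [K] points at mutual distance 1 into the universal group, which bounds the
    density from below. *)
Lemma discrete_seminorm (R : realType) (V : zmodType) :
  seminorm (fun x : V => (x != 0)%:R : R).
Proof.
split=> [|x y]; first by rewrite eqxx.
rewrite -natrD ler_nat; have [->|_] := eqVneq x 0; last by case: (_ - y != 0).
by rewrite sub0r oppr_eq0.
Qed.

Lemma lin_ext_seminorm (R : realType) (X : choiceType) (V : zmodType)
    (N : V -> R) (h : X -> V) :
  seminorm N -> seminorm (N \o lin_ext h).
Proof.
move=> N_snorm; split=> [|a b] /=; last by rewrite lin_extB snormB.
by rewrite -(subrr 0) lin_extB subrr snorm0.
Qed.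

Lemma isometric_injective (R : realType) (S T : metricType R) (f : S -> T) :
  isometric f -> injective f.
Proof.
move=> f_iso x y fxy; apply: (@mdist_positivity R).
by rewrite -f_iso fxy mdistxx.
Qed.

Section Universal.
Context (R : realType) (K : choiceType) (le : rel K).
Context (le_total : total_order le)
  (K_uncountable : ~ countable [set: K]) (K_pow : bounds_weak_power K K)
  (le_small : forall k, small K {l | le l k}).

Lemma exists_universal : exists G : invMetricZmodType R,
  has_density G K /\
  forall H : invMetricZmodType R, has_density_le H K ->
    exists f : {additive H -> G}, injective f /\ isometric f.
Proof.
have [G [pi [pi_surj piB pi_dist]]] :=
  seminorm_quotient (amalg_norm_seminorm R le_total).
exists G.
have emb_dist (p : snorms R K) x y :
    mdist (pi (emb le_total p x)) (pi (emb le_total p y)) = sval p (x - y).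
  by rewrite pi_dist -embB amalg_norm_emb.
split.
  pose p0 : snorms R K := Snorm (discrete_seminorm R (freeab K)).
  pose f k := pi (emb le_total p0 (gen k 1)).
  have f_sep k l : mdist (f k) (f l) < 1 -> k = l.
    rewrite emb_dist/=; apply: contraPeq => kl; apply/negP.
    rewrite -leNgt subr_eq0.
    have -> : gen k 1 != gen l 1; last exact: lexx.
    by apply/eqP => /freeabP/(_ k); rewrite /= eqxx (negPf kl).
  split; last by move=> D; exact: card_type_le_separated f_sep.
  exists [set: G]; split; first by move=> O O0 _; rewrite setIT.
  rewrite card_eq_le; apply/andP; split.
    apply: card_type_le_trans (surj_card_type_le pi_surj) _.
    exact: card_type_le_freeab_node.
  apply: (@inj_card_type_le _ _ f) => k l fkl; apply: f_sep.
  by rewrite fkl mdistxx.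
move=> H /(has_density_le_card K_uncountable K_pow) /card_type_leP[i iI].
(* Sending the generator at [k] to [h k] presents [H] as a quotient of the free group on [K];
   indices outside the range of [i] go to 0. *)
have [h hK] : exists h : K -> H, cancel i h.
  exists (fun k => if pselect (exists x, i x = k) is left e
    then projT1 (cid e) else 0) => x.
  case: pselect => [e|[]]; last by exists x.
  by case: cid => /= y /iI.
pose p : snorms R K :=
  Snorm (lin_ext_seminorm h (mdist_seminorm H)).
pose f y := pi (emb le_total p (gen (i y) 1)).
(* The generator at [i (x - y)] is not the difference of those at [i x] and [i y], but it is at
   [p]-distance 0 from it, so the two agree in [G]. *)
have fB : zmod_morphism f.
  move=> x y; apply: (@mdist_positivity R).
  rewrite -piB -embB emb_dist /= !lin_extB !lin_ext_gen !hK !mulr1z.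
  by rewrite subrr mdistxx.
have f_iso : isometric f.
  move=> x y; rewrite emb_dist /= lin_extB !lin_ext_gen !hK !mulr1z.
  exact: mdistB.
pose F := GRing.isZmodMorphism.Build H G f fB.
exists (HB.pack_for {additive H -> G} f F).
by split; [exact: isometric_injective|].
Qed.

End Universal.

Theorem mainTheorem4 (R : realType) (K : Type)
    (K_uncountable : ~ countable [set: K])
    (K_weak_power : weak_power_eq K K) :
  exists G : invMetricZmodType R,
    has_density G K /\
    forall H : invMetricZmodType R, has_density_le H K ->
      exists f : {additive H -> G}, injective f /\ isometric f.
Proof.
have [K_pow _] := K_weak_power.
have [le [le_total le_lt]] := exists_initial_well_order {classic K}.
apply: (@exists_universal R {classic K} le) => // k.
(* The closed segment up to [k] has one point more than the strict one; [None] stands for [k]. *)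
have := small_option K_uncountable K_pow (lt_small K_pow (le_lt k)).
apply: small_le => //; apply/card_type_leP.
exists (fun l => insub (sval l)) => -[x xk] [y yk] /= xy; apply/val_inj => /=.
case: insubP xy => [u _ <-|]; case: insubP => [v _ <-|] //; first by move=> [->].
by rewrite xk yk => /negPn/eqP -> /negPn/eqP ->.
Qed.
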